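(* In the setting described in the context, let $\bar n_w=\mathrm{rank}(Y_p\mathcal{N}(U_p))$. Then $$\bar n_w=\mathrm{rank}\begin{bmatrix} U_p \\ Y_p \end{bmatrix}-mT_{\mathrm{ini}}=n .$$ Consequently the parameter vector $g_w\in\mathbb{R}^{\bar n_w}$ in the parameterization $w=-Y_p\mathcal{N}(U_p)\mathcal{R}(\mathcal{N}(U_p)^\top Y_p^\top)g_w+w_0$ has length $n$, independent of the length $T_d$ of the historical data, and the matrix in the associated robust-tracking LMI written out in the context (one diagonal block of size $mT_f$ and one of size $1+\dim(g_w)$) has size scaling with $n+mT_f$.
   Context: $\mathcal{G}$ is a controllable and observable discrete-time LTI system $x_{k+1}=Ax_k+Bu_k$, $y_k=Cx_k+Du_k$, with $x_k\in\mathbb{R}^n$, $u_k\in\mathbb{R}^m$, $y_k\in\mathbb{R}^p$. A finite sequence $\{u_k,y_k\}$ is a trajectory of $\mathcal{G}$ if some state sequence makes these equations hold. Finite sequences are identified with the column vectors obtained by stacking them. The lag $\mathbf{l}(\mathcal{G})$ is the smallest $l$ such that $[C^\top,A^\top C^\top,\dots,(A^{l-1})^\top C^\top]^\top$ has full column rank. For a sequence $v$ of length $T$, $\mathcal{H}_L(v)$ is the Hankel matrix with $L$ block rows whose $j$-th column stacks the entries $j,\dots,j+L-1$ of $v$ ($T-L+1$ columns); $v$ is persistently exciting of order $L$ if $\mathcal{H}_L(v)$ has full row rank. $(\bar u,\bar y)$ is a trajectory of $\mathcal{G}$ of length $T_d$, and $$\begin{bmatrix} U_p \\ U_f \end{bmatrix}=\mathcal{H}_{T_{\mathrm{ini}}+T_f}(\bar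 u),\qquad \begin{bmatrix} Y_p \\ Y_f \end{bmatrix}=\mathcal{H}_{T_{\mathrm{ini}}+T_f}(\bar y),$$ where $U_p,Y_p$ are the first $T_{\mathrm{ini}}$ block rows and $U_f,Y_f$ the last $T_f$ block rows. Standing assumptions: $\bar u$ is persistently exciting of order $T_{\mathrm{ini}}+T_f+n$ and $T_{\mathrm{ini}}\ge\mathbf{l}(\mathcal{G})$. For a matrix $X$, $\mathcal{N}(X)$ denotes a matrix whose columns form a basis of $\ker(X)$, and $\mathcal{R}(X)$ one whose columns form a basis of the column space of $X$. $w_0=y_{\mathrm{ini}}-Y_pU_p^\top(U_pU_p^\top)^{-1}u_{\mathrm{ini}}$ for given recent data $u_{\mathrm{ini}}\in\mathbb{R}^{mT_{\mathrm{ini}}}$, $y_{\mathrm{ini}}\in\mathbb{R}^{pT_{\mathrm{ini}}}$. The associated robust-tracking LMI, in the unknowns $u\in\mathbb{R}^{mT_f}$, $\gamma\in\mathbb{R}$, $\alpha\ge0$, is $$\begin{bmatrix} (\bar R+B_u^\top\bar Q B_u)^{-1} & \begin{bmatrix} u & \mathbf{0}\end{bmatrix} \\ \begin{bmatrix} u^\top \\ \mathbf{0}\end{bmatrix} & Q_g(u,\gamma)+\begin{bmatrix} u^\top(\bar R+B_u^\top\bar Q B_u)u & \mathbf{0} \\ \mathbf{0}&\mathbf{0}\end{bmatrix}-\alpha A_w\end{bmatrix}\ge 0 .$$ Here $\bar Q=\mathbf{I}_{T_f}\otimes Q$ and $\bar R=\mathbf{I}_{T_f}\otimes R$ for symmetric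 weights $Q\ge0$, $R>0$. The matrix $B_u\in\mathbb{R}^{pT_f\times mT_f}$ and the symmetric matrices $A_w$ and $Q_g(u,\gamma)$, both of size $1+\dim(g_w)$, are such that, under the parameterization of $w$ by $g_w$, $[1,g_w^\top]A_w[1,g_w^\top]^\top\ge0$ expresses a given quadratic bound on the noise $w$, and $[1,g_w^\top]Q_g(u,\gamma)[1,g_w^\top]^\top\ge0$ expresses that the tracking cost $(y-r)^\top\bar Q(y-r)+u^\top\bar Ru$ is at most $\gamma$, where $r$ is a reference and the output $y$ is affine in $(u,g_w)$ with coefficient matrix $B_u$ on $u$. *)

(* Defs.v *)
From HB Require Import structures.
From mathcomp Require Import all_boot all_order all_algebra.
From mathcomp Require Import mxtens reals.

Set Implicit Arguments.
Unset Strict Implicit.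
Unset Printing Implicit Defensive.
Import Order.TTheory GRing.Theory Num.Theory.
Local Open Scope ring_scope.

Section LTI.
Variables (R : realType) (n m p : nat).
Variables (A : 'M[R]_n) (B : 'M[R]_(n, m)) (C : 'M[R]_(p, n)) (D : 'M[R]_(p, m)).

Definition controllable : Prop :=
  forall x0 x1 : 'cV[R]_n, exists (T : nat) (u : nat -> 'cV[R]_m) (x : nat -> 'cV[R]_n),
    [/\ x 0%N = x0, x T = x1
      & forall k, (k < T)%N -> x k.+1 = A *m x k + B *m u k].

Definition observable : Prop :=
  forall (u : nat -> 'cV[R]_m) (x x' : nat -> 'cV[R]_n),
    (forall k, x k.+1 = A *m x k + B *m u k) ->
    (forall k, x' k.+1 = A *m x' k + B *m u k) ->
    (forall k, C *m x k + D *m u k = C *m x' k + D *m u k) ->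
    x 0%N = x' 0%N.

Definition trajectory (T : nat) (u : T.-tuple 'cV[R]_m) (y : T.-tuple 'cV[R]_p) : Prop :=
  exists x : nat -> 'cV[R]_n, forall k, (k < T)%N ->
    x k.+1 = A *m x k + B *m u`_k /\ y`_k = C *m x k + D *m u`_k.

(* Block row k, for k < l, is C A^k. Matrices of l block rows of height p are
   indexed by 'I_(l * p), row (k, a) being mxtens_index (k, a) = k * p + a. *)
Definition obs_mx (l : nat) : 'M[R]_(l * p, n) :=
  \matrix_(i, j) (C *m A ^+ (mxtens_unindex i).1) (mxtens_unindex i).2 j.

(* row_full: full column rank. *)
Definition is_lag (l : nat) : Prop :=
  row_full (obs_mx l) /\ forall l', row_full (obs_mx l') -> (l <= l')%N.

End LTI.

Section Hankel.
Variable R : realType.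

(* For j < T + 1 - L the indices j, ..., j + L - 1 are all < T, so the default
   value of nth is never used. There are no columns when T < L. *)
Definition hankel (d T L : nat) (v : T.-tuple 'cV[R]_d) : 'M[R]_(L * d, T.+1 - L) :=
  \matrix_(i, j) v`_((mxtens_unindex i).1 + j) (mxtens_unindex i).2 0.

(* row_free: full row rank. *)
Definition persistently_exciting (d T L : nat) (v : T.-tuple 'cV[R]_d) : Prop :=
  row_free (hankel L v).

Definition split_rows (T1 T2 d q : nat) (M : 'M[R]_((T1 + T2) * d, q)) :
    'M[R]_(T1 * d + T2 * d, q) :=
  castmx (mulnDl T1 T2 d, erefl q) M.

Definition past (d T T1 T2 : nat) (v : T.-tuple 'cV[R]_d) :
    'M[R]_(T1 * d, T.+1 - (T1 + T2)) :=
  usubmx (split_rows (hankel (T1 + T2) v)).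

End Hankel.

Section Bases.
Variable R : realType.

(* MathComp subspaces are row spaces, hence the transposes: row_free N^T says
   that the columns of N are linearly independent, and the row space of
   kermx X^T consists of the v^T with X *m v = 0. *)
Definition kernel_basis (a q k : nat) (X : 'M[R]_(a, q)) (N : 'M[R]_(q, k)) : Prop :=
  row_free N^T /\ (N^T == kermx X^T)%MS.

Definition range_basis (a q k : nat) (X : 'M[R]_(a, q)) (V : 'M[R]_(a, k)) : Prop :=
  row_free V^T /\ (V^T == X^T)%MS.

End Bases.

Section Quadratic.
Variable R : realType.

Definition qform (d : nat) (M : 'M[R]_d) (v : 'cV[R]_d) : R := (v^T *m M *m v) 0 0.

Definition possemidef (d : nat) (M : 'M[R]_d) : Prop :=
  M^T = M /\ forall v, 0 <= qform M v.

Definition posdef (d : nat) (M : 'M[R]_d) : Prop :=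
  M^T = M /\ forall v, v != 0 -> 0 < qform M v.

Definition homog (d : nat) (v : 'cV[R]_d) : 'cV[R]_(1 + d) := col_mx 1%:M v.

Definition mxsize (a b : nat) (M : 'M[R]_(a, b)) : nat * nat := (a, b).

End Quadratic.

Section RobustTracking.
Variable R : realType.

Definition w_offset (a b q : nat) (Up : 'M[R]_(a, q)) (Yp : 'M[R]_(b, q))
    (uini : 'cV[R]_a) (yini : 'cV[R]_b) : 'cV[R]_b :=
  yini - Yp *m Up^T *m invmx (Up *m Up^T) *m uini.

(* N is N(Up) and V is R(N(Up)^T Yp^T). *)
Definition w_param (a b q k r : nat) (Up : 'M[R]_(a, q)) (Yp : 'M[R]_(b, q))
    (N : 'M[R]_(q, k)) (V : 'M[R]_(k, r)) (uini : 'cV[R]_a) (yini : 'cV[R]_b)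
    (gw : 'cV[R]_r) : 'cV[R]_b :=
  - (Yp *m N *m V *m gw) + w_offset Up Yp uini yini.

(* The quadratic bound on the noise is 0 <= qform Phi (homog w). *)
Definition expresses_noise_bound (b r : nat) (Phi : 'M[R]_(1 + b))
    (w : 'cV[R]_r -> 'cV[R]_b) (Aw : 'M[R]_(1 + r)) : Prop :=
  Aw^T = Aw /\
  forall gw, 0 <= qform Aw (homog gw) <-> 0 <= qform Phi (homog (w gw)).

Definition affine_output (a b r : nat) (Bu : 'M[R]_(b, a))
    (y : 'cV[R]_a -> 'cV[R]_r -> 'cV[R]_b) : Prop :=
  exists (Bg : 'M[R]_(b, r)) (y0 : 'cV[R]_b),
    forall u gw, y u gw = Bu *m u + Bg *m gw + y0.

Definition tracking_cost (a b : nat) (Qbar : 'M[R]_b) (Rbar : 'M[R]_a)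
    (yref : 'cV[R]_b) (u : 'cV[R]_a) (y : 'cV[R]_b) : R :=
  qform Qbar (y - yref) + qform Rbar u.

Definition expresses_cost_bound (a b r : nat) (Qbar : 'M[R]_b) (Rbar : 'M[R]_a)
    (yref : 'cV[R]_b) (y : 'cV[R]_a -> 'cV[R]_r -> 'cV[R]_b)
    (Qg : 'cV[R]_a -> R -> 'M[R]_(1 + r)) : Prop :=
  forall u gamma, (Qg u gamma)^T = Qg u gamma /\
    forall gw, 0 <= qform (Qg u gamma) (homog gw) <->
               tracking_cost Qbar Rbar yref u (y u gw) <= gamma.

(* The LMI in the unknowns u, gamma and alpha >= 0 is
   possemidef (lmi_mx Qbar Rbar Bu Aw Qg u gamma alpha). *)
Definition lmi_mx (a b r : nat) (Qbar : 'M[R]_b) (Rbar : 'M[R]_a) (Bu : 'M[R]_(b, a))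
    (Aw : 'M[R]_(1 + r)) (Qg : 'cV[R]_a -> R -> 'M[R]_(1 + r))
    (u : 'cV[R]_a) (gamma alpha : R) : 'M[R]_(a + (1 + r)) :=
  let H := Rbar + Bu^T *m Qbar *m Bu in
  block_mx (invmx H)       (row_mx u 0)
           (col_mx u^T 0)  (Qg u gamma + block_mx (u^T *m H *m u) 0 0 0 - alpha *: Aw).

End RobustTracking.

(* Main.v *)
Require Import Defs.
From mathcomp Require Import all_boot all_order all_algebra.
From mathcomp Require Import mxtens reals.
Import Order.TTheory GRing.Theory Num.Theory.
Local Open Scope ring_scope.

(** The core is Willems' fundamental lemma: the inputs [Up] and the initial states
    [X] of the Hankel columns stack to a matrix of full row rank.  Let
    [(xi, eta)] annihilate this stack.  Each forward shift by [k <= n], with the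
    state [x_(j+k)] expanded through [A^k x_j], gives another annihilator; combining
    the shifts with the coefficients of the characteristic polynomial of [A]
    removes the state and leaves an annihilator of the Hankel matrix of depth
    [Tini + Tf + n], which is zero.  Reading its coefficients from the top down
    gives [eta = 0], then [xi A^i B = 0] for all [i], hence [xi = 0].

    Since [Yp = G Up + O X] with [O] the observability matrix, injective because
    [lag <= Tini], multiplying by a kernel basis [N] of [Up] gives
    [rank (Yp N) = rank (X N) = rank [Up; X] - rank Up = n]. *)

(** * Cayley-Hamilton, reachability and excitation *)

Lemma char_poly_annihilates (F : comNzRingType) (n : nat) (A : 'M[F]_n) :
  exists c : nat -> F, c n = 1 /\ \sum_(k < n.+1) c k *: A ^+ k = 0.
Proof.
case: n A => [|n] A.
  by exists (fun=> 1); split => //; rewrite [LHS]flatmx0 [RHS]flatmx0.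
exists (fun k => (char_poly A)`_k); split.
  have /monicP := char_poly_monic A.
  by rewrite /lead_coef size_char_poly.
have := Cayley_Hamilton A; rewrite /horner_mx /horner_morph => E.
rewrite -[RHS]E horner_coef.
rewrite size_map_poly_id0 ?size_char_poly; last first.
  by rewrite (monicP (char_poly_monic A)) rmorph1 oner_eq0.
by apply: eq_bigr => i _; rewrite coef_map; apply/esym/mul_scalar_mx.
Qed.

Lemma sum_mxtens (V : nmodType) (a b : nat) (f : 'I_a -> 'I_b -> V) :
  \sum_(s < a * b) f (mxtens_unindex s).1 (mxtens_unindex s).2
  = \sum_i \sum_j f i j.
Proof.
rewrite pair_bigA (reindex (@mxtens_index a b)).
  by apply: eq_bigr => -[i j] _; rewrite mxtens_indexK.
by exists (@mxtens_unindex a b) => ? _; rewrite ?mxtens_indexK ?mxtens_unindexK.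
Qed.

Lemma state_response (F : pzRingType) (n m T : nat) (A : 'M[F]_n)
    (B : 'M[F]_(n, m)) (u : nat -> 'cV[F]_m) (x : nat -> 'cV[F]_n) (j k : nat) :
  (forall t, (t < T)%N -> x t.+1 = A *m x t + B *m u t) ->
  (j + k <= T)%N ->
  x (j + k)%N = A ^+ k *m x j + \sum_(i < k) A ^+ (k - i.+1) *m B *m u (j + i)%N.
Proof.
move=> Hx; elim: k => [|k IH] Hk; first by rewrite addn0 big_ord0 addr0 expr0 mul1mx.
rewrite addnS in Hk *; rewrite Hx // IH ?(ltnW Hk) // mulmxDr -addrA; congr (_ + _).
  by rewrite exprS mulmxA.
rewrite big_ord_recr /= subnn expr0 mul1mx; congr (_ + _).
rewrite mulmx_sumr; apply: eq_bigr => i _.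
by rewrite subSn // exprS !mulmxA.
Qed.

(** Every state is reached from 0, so it is a sum of vectors of the form [A ^+ i *m B *m v], all
    killed by [xi]. *)
Lemma controllable_separates (R : realType) (n m : nat) (A : 'M[R]_n)
    (B : 'M[R]_(n, m)) (xi : 'rV[R]_n) :
  controllable A B -> (forall i, xi *m A ^+ i *m B = 0) -> xi = 0.
Proof.
move=> HC Hxi.
have H1 (x1 : 'cV_n) : xi *m x1 = 0.
  have [T [u [x [x0 <- Hx]]]] := HC 0 x1.
  rewrite -[T]add0n (@state_response _ _ _ T A B u x 0 T Hx) //.
  rewrite x0 mulmx0 add0r mulmx_sumr big1 // => i _.
  by rewrite !mulmxA Hxi mul0mx.
apply/rowP => i; have := H1 (delta_mx i 0).
by rewrite -colE => /matrixP/(_ 0 0); rewrite !mxE.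
Qed.

(** Left-kernel vectors of the Hankel matrix are handled as sequences of blocks [theta i], on which
    a time shift is a shift of the index. *)
Lemma persistently_exciting_inj (R : realType) (d T L : nat)
    (v : T.-tuple 'cV[R]_d) (theta : nat -> 'rV[R]_d) :
  persistently_exciting L v ->
  (forall j, (j < T.+1 - L)%N -> \sum_(i < L) theta i *m v`_(i + j) = 0) ->
  forall i, (i < L)%N -> theta i = 0.
Proof.
move=> HP H.
pose M : 'rV[R]_(L * d) := \row_s theta (mxtens_unindex s).1 0 (mxtens_unindex s).2.
have M0 : M = 0.
  apply: (row_free_inj HP); rewrite mul0mx; apply/rowP => j; rewrite !mxE.
  under eq_bigr do rewrite !mxE.
  rewrite (@sum_mxtens _ _ _ (fun i b => theta i 0 b * v`_(i + j) b 0)).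
  have := congr1 (fun Z : 'M_1 => Z 0 0) (H j (ltn_ord j)).
  rewrite summxE [RHS]mxE => E; rewrite -[RHS]E.
  by apply: eq_bigr => i _; rewrite mxE.
move=> i Hi; apply/rowP => b.
have := congr1 (fun Z : 'rV_(L * d) => Z 0 (mxtens_index (Ordinal Hi, b))) M0.
by rewrite !mxE mxtens_indexK.
Qed.

(** Drives the inductions on [eta] and on [xi *m A ^+ i *m B], with [c] the coefficients of the
    characteristic polynomial. *)
Lemma monic_recurrence_eq0 (F : pzRingType) (V : lmodType F) (n : nat)
    (c : nat -> F) (a : nat -> V) :
  c n = 1 -> \sum_(k < n.+1) c k *: a k = 0 ->
  (forall k, (k < n)%N -> a k = 0) -> a n = 0.
Proof.
move=> cn; rewrite big_ord_recr /= cn scale1r => H Ha.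
by rewrite -[RHS]H big1 ?add0r // => i _; rewrite Ha ?scaler0.
Qed.

(** * Willems' fundamental lemma *)

(** [eta] is a sequence vanishing from [L] on, so that its shifts make sense on the longer window of
    length [L + n]. *)
Lemma fundamental_left_kernel (R : realType) (n m T L : nat) (A : 'M[R]_n)
    (B : 'M[R]_(n, m)) (u : T.-tuple 'cV[R]_m) (x : nat -> 'cV[R]_n)
    (xi : 'rV[R]_n) (eta : nat -> 'rV[R]_m) :
  controllable A B ->
  persistently_exciting (L + n) u ->
  (forall t, (t < T)%N -> x t.+1 = A *m x t + B *m u`_t) ->
  (forall i, (L <= i)%N -> eta i = 0) ->
  (forall j, (j < T.+1 - L)%N ->
     xi *m x j + \sum_(i < L) eta i *m u`_(i + j) = 0) ->
  xi = 0 /\ forall i, eta i = 0.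
Proof.
move=> HC HP Hx eta0 H.
have [c [cn cA]] := char_poly_annihilates _ _ A.
(* The input part of the annihilator [(xi, eta)] shifted by [k]. *)
pose theta k i := if (i < k)%N then xi *m A ^+ (k - i.+1) *m B else eta (i - k)%N.
pose Theta i := \sum_(k < n.+1) c k *: theta k i.
have ThetaE i : (i < L + n)%N -> Theta i = 0.
  apply: (persistently_exciting_inj _ _ _ _ _ _ HP) => j Hj.
  have Hin (k : 'I_n.+1) :
      \sum_(i < L + n) theta k i *m u`_(i + j) = - (xi *m A ^+ k *m x j).
    have kn : (k <= n)%N by rewrite -ltnS.
    (* Depth [L + n] leaves room for [n] shifts: column [j + k] of the Hankel matrix of depth [L]
       still exists. *)
    have Hjk : (j + k < T.+1 - L)%N.
      rewrite ltn_subRL in Hj; rewrite ltn_subRL; apply: leq_trans Hj.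
      by rewrite ltnS [(j + k)%N]addnC addnA leq_add2r leq_add2l.
    have jkT : (j + k <= T)%N.
      by rewrite -ltnS; apply: leq_trans Hjk _; exact: leq_subr.
    have /eqP := H (j + k)%N Hjk.
    rewrite (state_response _ _ _ T A B (fun t => u`_t) x j k Hx jkT).
    rewrite mulmxDr -addrA addr_eq0 mulmxA => /eqP ->; rewrite opprK.
    (* The window splits at [k] and [k + L]: the terms before [k] come from expanding the state, the
       next [L] carry [eta], the rest have coefficient 0. *)
    rewrite -(big_mkord xpredT (fun i => theta k i *m u`_(i + j))).
    rewrite (@big_cat_nat _ _ _ k) //=; last by rewrite (leq_trans kn) ?leq_addl.
    congr (_ + _).
      rewrite big_mkord mulmx_sumr; apply: eq_bigr => s _.
      by rewrite /theta ltn_ord !mulmxA addnC.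
    rewrite -{1}[k : nat]add0n big_addn.
    rewrite (@big_cat_nat _ _ _ L) //=; last by rewrite -addnBA // leq_addr.
    rewrite [X in _ + X]big_nat_cond [X in _ + X]big1 ?addr0; last first.
      move=> s /andP[/andP[Ls _] _].
      by rewrite /theta ltnNge leq_addl /= addnK eta0 // mul0mx.
    rewrite big_mkord; apply: eq_bigr => s _; rewrite /theta ltnNge leq_addl /= addnK.
    by rewrite -addnA [(k + j)%N]addnC.
  under eq_bigr do rewrite mulmx_suml.
  rewrite exchange_big /=.
  have E : - (xi *m (\sum_(k < n.+1) c k *: A ^+ k) *m x j) = 0.
    by rewrite cA mulmx0 mul0mx oppr0.
  rewrite -[RHS]E.
  rewrite mulmx_sumr mulmx_suml -sumrN; apply: eq_bigr => k _.
  under eq_bigr do rewrite -scalemxAl.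
  by rewrite -scaler_sumr Hin -scalemxAr -scalemxAl scalerN.
have etaE i : eta i = 0.
  have [Li|iL] := leqP L i; first exact: eta0.
  (* Descending induction on [i], with [d] bounding [L - i]. At position [i + n], shift [k]
     contributes [eta (i + (n - k))], and only [k = n] reaches [eta i]. *)
  have [d] := ubnP (L - i); elim: d i iL => // d IH i iL Hd.
  have IH' k : (i < k)%N -> eta k = 0.
    move=> ik; have [Lk|kL] := leqP L k; first exact: eta0.
    apply: IH => //; rewrite -ltnS; apply: leq_trans Hd; rewrite ltnS.
    exact: ltn_sub2l.
  have := ThetaE (i + n)%N; rewrite ltn_add2r => /(_ iL).
  have thE k : (k <= n)%N -> theta k (i + n)%N = eta (i + (n - k))%N.
    by move=> kn; rewrite /theta ltnNge (leq_trans kn) ?leq_addl //= addnBA.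
  move=> /(monic_recurrence_eq0 _ _ n c (fun k => theta k (i + n)%N) cn).
  rewrite thE // subnn addn0; apply => k kn.
  by rewrite thE ?(ltnW kn) // IH' // -[ltnLHS]addn0 ltn_add2l subn_gt0.
split=> //; apply: (controllable_separates _ _ _ A B xi HC) => i.
have [d] := ubnP i; elim: d i => // d IH i; rewrite ltnS => Hid.
have IH' k : (k < i)%N -> xi *m A ^+ k *m B = 0.
  by move=> ki; apply: IH; apply: leq_trans Hid.
have [ni|ni] := leqP n i.
  (* Beyond degree n, Cayley-Hamilton multiplied by A^(i - n) drives the recurrence. *)
  have -> : i = (n + (i - n))%N by rewrite subnKC.
  apply: (monic_recurrence_eq0 _ _ n c
    (fun k => xi *m A ^+ (k + (i - n)) *m B) cn); last first.
    by move=> k kn; apply: IH'; rewrite -[ltnRHS](subnKC ni) ltn_add2r.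
  have := congr1 (fun M => xi *m (M *m A ^+ (i - n)) *m B) cA.
  rewrite mul0mx mulmx0 mul0mx => E; rewrite -[RHS]E.
  rewrite mulmx_suml mulmx_sumr mulmx_suml; apply: eq_bigr => k _.
  by rewrite -scalemxAl -scalemxAr -scalemxAl exprD.
(* For [i < n], at position [n - i - 1], shift [n] contributes [xi *m A ^+ i *m B]; a smaller shift
   gives a lower power of [A] or a block of [eta]. *)
have := ThetaE (n - i.+1)%N.
have lt : (n - i.+1 < n)%N by rewrite ltn_subrL (leq_trans _ ni).
rewrite (leq_trans lt) ?leq_addl // => /(_ isT).
move=> /(monic_recurrence_eq0 _ _ n c (fun k => theta k (n - i.+1)%N) cn).
rewrite /theta lt subnSK // subKn 1?ltnW //; apply => k kn.
case: leqP => [lk|_]; last exact: etaE.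
by apply: IH'; rewrite ltn_subLR // subnK // ltnW.
Qed.

(** * Rank on a kernel and observability matrices *)

(** Rank-nullity for [Z] restricted to the kernel of [U], which is the column space of [N]; the
    kernel of this restriction is the kernel of the stack. *)
Lemma rank_mul_kernel_basis (R : realType) (a b q k : nat) (U : 'M[R]_(a, q))
    (Z : 'M[R]_(b, q)) (N : 'M[R]_(q, k)) :
  kernel_basis U N -> (\rank (Z *m N) + \rank U)%N = \rank (col_mx U Z).
Proof.
move=> [_ /eqmxP HN].
have := mxrank_mul_ker N^T Z^T.
rewrite -trmx_mul mxrank_tr HN.
have -> : \rank (N^T :&: kermx Z^T)%MS = \rank (kermx (col_mx U Z)^T).
  apply/eqmx_rank/andP; split; last first.
    by rewrite sub_capmx HN !sub_kermx -row_mx_eq0 -mul_mx_row -tr_col_mx mulmx_ker.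
  rewrite sub_kermx tr_col_mx mul_mx_row row_mx_eq0 -!sub_kermx.
  by rewrite capmxSr andbT (submx_trans (capmxSl _ _)) // HN.
rewrite !mxrank_ker !mxrank_tr => E.
(* These bounds make the truncated subtractions exact. *)
have r1 := rank_leq_col U; have r2 := rank_leq_col (col_mx U Z).
apply: (@addIn (q - \rank (col_mx U Z))%N); rewrite subnKC // addnAC E subnK //.
Qed.

Lemma obs_mx_row_full_mono (R : realType) (n p l l' : nat) (A : 'M[R]_n)
    (C : 'M[R]_(p, n)) :
  (l <= l')%N -> row_full (obs_mx A C l) -> row_full (obs_mx A C l').
Proof.
move=> ll' Hf; rewrite -sub1mx; apply: submx_trans (_ : (obs_mx A C l <= _)%MS).
  by rewrite sub1mx.
apply/row_subP => s; set i := (mxtens_unindex s).1.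
have -> : row s (obs_mx A C l) =
    row (mxtens_index (widen_ord ll' i, (mxtens_unindex s).2)) (obs_mx A C l').
  by apply/rowP => j; rewrite !mxE mxtens_indexK.
exact: row_sub.
Qed.

(** * Past inputs, outputs and states *)

Lemma pastE (R : realType) (d T T1 T2 : nat) (v : T.-tuple 'cV[R]_d) s j :
  past T1 T2 v s j = v`_((mxtens_unindex s).1 + j) (mxtens_unindex s).2 0.
Proof.
rewrite /past /split_rows mxE castmxE mxE /=.
by congr (fun_of_matrix _ _ _); apply: val_inj.
Qed.

(** A left-kernel vector of the stack, given zero weights on the future inputs, fits
    [fundamental_left_kernel] with [L = T1 + T2]. *)
Lemma past_state_row_free (R : realType) (n m T T1 T2 : nat) (A : 'M[R]_n)
    (B : 'M[R]_(n, m)) (u : T.-tuple 'cV[R]_m) (x : nat -> 'cV[R]_n) :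
  controllable A B ->
  persistently_exciting (T1 + T2 + n) u ->
  (forall t, (t < T)%N -> x t.+1 = A *m x t + B *m u`_t) ->
  row_free (col_mx (past T1 T2 u) (\matrix_(i, j) x j i 0)).
Proof.
move=> HC HP Hx; apply: inj_row_free => v; rewrite -[v]hsubmxK mul_row_col.
set e := lsubmx v; set xi := rsubmx v => H.
pose eta i := if insub i is Some i' then
  \row_b e 0 (mxtens_index (i' : 'I_T1, b)) else 0 : 'rV[R]_m.
have etaE (i : 'I_T1) b : eta i 0 b = e 0 (mxtens_index (i, b)).
  by rewrite /eta valK mxE.
have eta0 i : (T1 <= i)%N -> eta i = 0.
  by move=> Ti; rewrite /eta insubN // -leqNgt.
have [|xi0 eta00] := fundamental_left_kernel _ _ _ _ _ A B u x xi eta HC HP Hx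
    (fun i Hi => eta0 i (leq_trans (leq_addr _ _) Hi)).
  move=> j Hj; apply/matrixP => a b; rewrite !ord1.
  have := congr1 (fun Z : 'rV_(T.+1 - (T1 + T2)) => Z 0 (Ordinal Hj)) H.
  rewrite !mxE addrC => E; rewrite -[RHS]E; congr (_ + _).
    by apply: eq_bigr => i _; rewrite !mxE.
  rewrite big_split_ord /= [X in _ + X]big1 ?addr0; last first.
    by move=> i _; rewrite eta0 ?leq_addr // mul0mx.
  rewrite summxE.
  under [RHS]eq_bigr => s _.
    rewrite pastE -[s in e 0 s]mxtens_unindexK
      [mxtens_unindex s]surjective_pairing -etaE; over.
  rewrite (@sum_mxtens _ _ _ (fun i b => eta i 0 b * u`_(i + j) b 0)).
  by apply: eq_bigr => i _; rewrite mxE.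
rewrite xi0; suff -> : e = 0 by rewrite row_mx0.
apply/rowP => s; rewrite -[s]mxtens_unindexK [mxtens_unindex s]surjective_pairing.
by rewrite -etaE eta00 !mxE.
Qed.

(** This is [Yp = G Up + O X], with [G] left implicit in a row-space inclusion so that the block
    Toeplitz matrix need not be assembled. *)
Lemma past_output_sub (R : realType) (n m p T T1 T2 : nat) (A : 'M[R]_n)
    (B : 'M[R]_(n, m)) (C : 'M[R]_(p, n)) (D : 'M[R]_(p, m))
    (u : T.-tuple 'cV[R]_m) (y : T.-tuple 'cV[R]_p) (x : nat -> 'cV[R]_n) :
  (forall t, (t < T)%N ->
     x t.+1 = A *m x t + B *m u`_t /\ y`_t = C *m x t + D *m u`_t) ->
  (past T1 T2 y - obs_mx A C T1 *m \matrix_(i, j) x j i 0 <= past T1 T2 u)%MS.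
Proof.
move=> Hxy; set q := (T.+1 - (T1 + T2))%N.
pose Ub i : 'M[R]_(m, q) := \matrix_(a, j) u`_(i + j) a 0.
have UbS i : (i < T1)%N -> (Ub i <= past T1 T2 u)%MS.
  move=> iT; apply/row_subP => a.
  have -> : row a (Ub i) = row (mxtens_index (Ordinal iT, a)) (past T1 T2 u).
    by apply/rowP => j; rewrite [RHS]mxE pastE mxtens_indexK !mxE.
  exact: row_sub.
have UbE d (M : 'M_(d, m)) b i j : (row b M *m Ub i) 0 j = (M *m u`_(i + j)) b 0.
  by rewrite !mxE; apply: eq_bigr => l _; rewrite !mxE.
apply/row_subP => s; set i := (mxtens_unindex s).1; set a := (mxtens_unindex s).2.
have iT : (i < T1)%N := ltn_ord i.
(* The coefficients are the Markov parameters: row [a] of [C A^(i-t-1) B] on input block [t < i],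
   and of [D] on block [i]. *)
have -> : row s (past T1 T2 y - obs_mx A C T1 *m \matrix_(i, j) x j i 0) =
    \sum_(t < i) row a (C *m A ^+ (i - t.+1) *m B) *m Ub t + row a D *m Ub i.
  apply/rowP => j.
  have jiT : (j + i < T)%N.
    have := ltn_ord j; rewrite ltn_subRL ltnS; apply: leq_trans.
    by rewrite addnC -addSn leq_add2r (leq_trans iT) ?leq_addr.
  have xji := state_response _ _ _ T A B (fun t => u`_t) x j i
    (fun t Ht => (Hxy t Ht).1) (ltnW jiT).
  have [_] := Hxy _ jiT; rewrite xji => yji.
  rewrite mxE [LHS]mxE pastE -/i -/a [(i + j)%N]addnC yji.
  have -> : (- (obs_mx A C T1 *m \matrix_(i, j) x j i 0)) s j =
      (- (C *m A ^+ i *m x j)) a 0.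
    by rewrite !mxE; congr (- _); apply: eq_bigr => l _; rewrite !mxE.
  have addE (V W : 'cV[R]_p) : V a 0 + W a 0 = (V + W) a 0 by rewrite mxE.
  rewrite addE mulmxDr mulmxA addrAC [C *m A ^+ i *m x j + _]addrC addrK mulmx_sumr.
  rewrite [LHS]mxE [RHS]mxE !summxE UbE [(j + i)%N]addnC.
  by congr (_ + _); apply: eq_bigr => t _; rewrite UbE !mulmxA [(j + t)%N]addnC.
apply: addmx_sub.
  apply: summx_sub => t _; rewrite (submx_trans (submxMl _ _)) // UbS //.
  exact: ltn_trans (ltn_ord t) iT.
by rewrite (submx_trans (submxMl _ _)) // UbS.
Qed.

Theorem mainTheorem4 (R : realType) (n m p : nat)
  (A : 'M[R]_n) (B : 'M[R]_(n, m)) (C : 'M[R]_(p, n)) (D : 'M[R]_(p, m))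
  (Tini Tf lag Td : nat)
  (ud : Td.-tuple 'cV[R]_m) (yd : Td.-tuple 'cV[R]_p) :
  controllable A B ->
  observable A B C D ->
  is_lag A C lag ->
  (lag <= Tini)%N ->
  trajectory A B C D ud yd ->
  persistently_exciting (Tini + Tf + n) ud ->
  let Up := past Tini Tf ud in
  let Yp := past Tini Tf yd in
  forall (k : nat) (N : 'M[R]_(Td.+1 - (Tini + Tf), k)),
  kernel_basis Up N ->
  let nw := \rank (Yp *m N) in
  [/\ 
      nw%:Z = (\rank (col_mx Up Yp))%:Z - (m * Tini)%:Z,
      (\rank (col_mx Up Yp))%:Z - (m * Tini)%:Z = n%:Z
    & 
      forall (r : nat) (V : 'M[R]_(k, r)),
      range_basis (N^T *m Yp^T) V ->
      [/\ r = nw, r = n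
        & forall (uini : 'cV[R]_(Tini * m)) (yini : 'cV[R]_(Tini * p))
                 (Q : 'M[R]_p) (Rw : 'M[R]_m) (yref : 'cV[R]_(Tf * p))
                 (Phi : 'M[R]_(1 + Tini * p)) (Aw : 'M[R]_(1 + r))
                 (Bu : 'M[R]_(Tf * p, Tf * m))
                 (y : 'cV[R]_(Tf * m) -> 'cV[R]_r -> 'cV[R]_(Tf * p))
                 (Qg : 'cV[R]_(Tf * m) -> R -> 'M[R]_(1 + r)),
          let Qbar := 1%:M *t Q in
          let Rbar := 1%:M *t Rw in
          possemidef Q ->
          posdef Rw ->
          Phi^T = Phi ->
          expresses_noise_bound Phi (w_param Up Yp N V uini yini) Aw ->
          affine_output Bu y ->
          expresses_cost_bound Qbar Rbar yref y Qg ->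
          forall (u : 'cV[R]_(Tf * m)) (gamma alpha : R),
          0 <= alpha ->
          mxsize (lmi_mx Qbar Rbar Bu Aw Qg u gamma alpha)
          = ((n + m * Tf).+1, (n + m * Tf).+1)]].
Proof.
move=> HC HO [Hlag _] lagT [x Hxy] HP Up Yp k N HN nw.
pose X : 'M[R]_(n, Td.+1 - (Tini + Tf)) := \matrix_(i, j) x j i 0.
have freeM : row_free (col_mx Up X).
  exact: (past_state_row_free _ _ _ _ _ _ _ _ _ _ HC HP (fun t Ht => (Hxy t Ht).1)).
(* The stack has rank [Tini * m + n] and [X] contributes at most [n], so [Up] has full row rank. *)
have rUp : \rank Up = (Tini * m)%N.
  have : \rank (col_mx Up X) = (Tini * m + n)%N by apply/eqP.
  have := rank_leq_row Up; have := rank_leq_row X.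
  have := mxrank_adds_leqif Up X; rewrite addsmxE => -[+ _].
  move=> a b c d; apply/eqP; rewrite eqn_leq c /=; move: a; rewrite d => a.
  by rewrite -(leq_add2r n) (leq_trans a) // leq_add2l.
have UpN : Up *m N = 0.
  apply: trmx_inj; rewrite trmx_mul trmx0; apply/eqP; rewrite -sub_kermx.
  by have [_ /andP[]] := HN.
have rnw : nw = n.
  have /submxP [G HG] := past_output_sub _ _ _ _ _ Tini Tf _ _ _ _ _ _ _ Hxy.
  have /eqmx_rank rk : (Yp *m N == X *m N)%MS.
    apply/eqmxP.
    have -> : Yp *m N = obs_mx A C Tini *m (X *m N).
      move/eqP: HG; rewrite subr_eq -/Yp -/Up -/X => /eqP ->.
      by rewrite mulmxDl -(mulmxA G) UpN mulmx0 add0r mulmxA.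
    exact: eqmxMfull (obs_mx_row_full_mono _ _ _ _ _ _ _ lagT Hlag).
  have := rank_mul_kernel_basis _ _ _ _ _ Up X N HN.
  rewrite -rk rUp (eqP freeM) addnC => /addnI; exact.
have E : (nw + m * Tini)%N = \rank (col_mx Up Yp).
  by rewrite -(rank_mul_kernel_basis _ _ _ _ _ Up Yp N HN) rUp mulnC.
split.
- by rewrite -E PoszD addrK.
- by rewrite -E PoszD addrK rnw.
move=> r V [/eqP freeV /eqmxP eV].
(* The basis [V] has as many columns as the rank of [N^T *m Yp^T], the transpose of [Yp *m N]. *)
have rE : r = nw by rewrite -freeV eV mxrank_tr -trmx_mul mxrank_tr.
split=> // [|*]; first by rewrite rE.
by rewrite /mxsize rE rnw mulnC add1n addnS [(n + _)%N]addnC.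
Qed.
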